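(* Let $n\ge 3$ be even. A sequence $(a_1,\ldots,a_n;b_1,\ldots,b_n;s)$ of positive integers, with $a_1=\ldots=a_n=a$ and $b_1=\ldots=b_n=b$, is an essential Betti sequence provided that 1) $s=n(b-a)$; 2) $na<(n-1)b\le na+\frac{n-2}{2}(b-a)$.
   Context: $k$ is a field. A sequence $(a_1,\ldots,a_n;b_1,\ldots,b_n;s)$ is called an essential Betti sequence if there is a homogeneous ideal $I$ of height at least $2$ in a standard graded polynomial ring $R=k[x_1,\ldots,x_r]$ for some $r\ge 3$ (the number of variables is not prescribed) such that $R/I$ has a graded minimal free resolution $$0\to R(-s)\to\bigoplus_{j=1}^n R(-b_j)\to\bigoplus_{i=1}^n R(-a_i)\to R\to R/I\to 0.$$ *)

(* Defs.v *)
From mathcomp Require Import all_boot all_order all_algebra.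
From mathcomp Require Import mpoly.

Set Implicit Arguments.
Unset Strict Implicit.
Unset Printing Implicit Defensive.

Import GRing.Theory.
Local Open Scope ring_scope.

Section Height.
Variable R : comNzRingType.

Definition proper_subset (P Q : prime_idealr R) : Prop :=
  {subset P <= Q} /\ (exists2 x, x \in Q & x \notin P).

(* Some chain of primes C 0 < C 1 < ... < C h descends from P = C h. *)
Definition prime_height_ge (h : nat) (P : prime_idealr R) : Prop :=
  exists C : nat -> prime_idealr R,
    (forall i, (i < h)%N -> proper_subset (C i) (C i.+1)) /\ C h =i P.

(* The height of I is the infimum of the heights of the primes containing I. *)
Definition height_ge (h : nat) (I : idealr R) : Prop :=
  forall P : prime_idealr R, {subset I <= P} -> prime_height_ge h P.

(* Matrices act on row vectors from the right, so an m x n matrix is a map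
   R^m -> R^n; this is exactness of R^m -> R^n -> R^p at the middle term. *)
Definition exact_at (m n p : nat) (A : 'M[R]_(m, n)) (B : 'M[R]_(n, p)) : Prop :=
  forall v : 'rV[R]_n, v *m B = 0 <-> (exists u : 'rV[R]_m, v = u *m A).

End Height.

Section GradedMaps.
Variables (k : fieldType) (r : nat).
Local Notation R := {mpoly k[r]}.

Definition homogeneous_ideal (I : idealr R) : Prop :=
  forall (p : R) (d : nat), p \in I -> pihomog mdeg d p \in I.

(* M is a degree 0 map of graded modules
     (+)_j R(-src j) -> (+)_i R(-tgt i):
   the entry (j, i) lies in R_(src j - tgt i), which is 0 in negative degree. *)
Definition graded_map (m n : nat) (src : 'I_m -> nat) (tgt : 'I_n -> nat)
    (M : 'M[R]_(m, n)) : Prop :=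
  forall j i, ((tgt i <= src j)%N -> M j i \is (src j - tgt i)%N.-homog)
              /\ ((src j < tgt i)%N -> M j i = 0).

(* The image of M lies in (x_1, ..., x_r) times the target. *)
Definition minimal_map (m n : nat) (M : 'M[R]_(m, n)) : Prop :=
  forall j i, (M j i)@_0%MM = 0.

(* 0 -> R(-s) -> (+)_j R(-b j) -> (+)_i R(-a i) -> R -> R/I -> 0,
   with differentials d3, d2, d1 from left to right; exactness at R says that
   the image of d1 is I. *)
Record minimal_graded_resolution (n : nat) (I : idealr R) (a b : 'I_n -> nat)
    (s : nat) (d1 : 'M[R]_(n, 1)) (d2 : 'M[R]_(n, n)) (d3 : 'M[R]_(1, n)) :
    Prop := MinimalGradedResolution {
  graded_d1 : graded_map a (fun=> 0%N) d1;
  graded_d2 : graded_map b a d2;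
  graded_d3 : graded_map (fun=> s) b d3;
  exact_R : forall f : R, f \in I <-> (exists v : 'rV[R]_n, f%:M = v *m d1);
  exact_a : exact_at d2 d1;
  exact_b : exact_at d3 d2;
  exact_s : injective (fun u : 'rV[R]_1 => u *m d3);
  minimal_d1 : minimal_map d1;
  minimal_d2 : minimal_map d2;
  minimal_d3 : minimal_map d3
}.

End GradedMaps.

(* An idealr is a proper ideal; minimality of d1 rules out I = R anyway. *)
Definition essential_betti_sequence (k : fieldType) (n : nat)
    (a b : 'I_n -> nat) (s : nat) : Prop :=
  exists (r : nat) (I : idealr {mpoly k[r]}),
    [/\ (3 <= r)%N, homogeneous_ideal I, height_ge 2 I &
        exists (d1 : 'M[{mpoly k[r]}]_(n, 1)) (d2 : 'M[{mpoly k[r]}]_(n, n))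
               (d3 : 'M[{mpoly k[r]}]_(1, n)),
          minimal_graded_resolution I a b s d1 d2 d3].

Arguments essential_betti_sequence k {n} a b s.

(* Main.v *)
Require Import Defs.
From HB Require Import structures.
From mathcomp Require Import all_boot all_order all_algebra.
From mathcomp Require Import mpoly zify ring.

(** Put [d = b - a].  The ideal is generated by [n] monomials in [n] variables,
    and its resolution is the cellular one carried by an [n]-gon: the vertices
    are the generators [Y j], the edge [j] joins [Y (j - 1)] to [Y j] and is
    labelled by their least common multiple, and the only face is labelled by
    the least common multiple [F] of everything.  The differentials are the
    boundary maps of the polygon, made homogeneous by the labels.

    Exactness is tested one multidegree [m] at a time.  At the vertices it says
    that the generators dividing the monomial [m] form a connected subset of the
    cycle; this is where the labels matter ([connected_below],
    [exact_vertices]).  At the edges it holds for every labelling: an edge cycle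
    [v] has all the products [v_j * 'X_[edge j]] equal, so their common value
    is divisible by [F] ([exact_edges]).

    The generators are
      [Y j = \prod_i 'X_i ^+ exponent (j - i mod n)],
      [exponent t = min (d, max (a - d t, 0))].
    The values of [exponent] on [0 .. n-1] add up to [a], decrease from [d] at
    [0] to [0] at [n-1], and so passing from [Y (j - 1)] to the edge [j] changes
    only the exponent of ['X_j], from [0] to [d]: the edges have degree
    [a + d = b] and the face, with all exponents [d], has degree [n d = s].
    The two inequalities of the theorem, with [n] even, say
    [n d / 2 <= a < (n - 1) d].  The upper bound makes the last exponent vanish
    and gives [b < s], which minimality requires.  By the lower bound a vertex
    at which the exponent of ['X_t] is less than [d] lies at least half a turn
    beyond [t].  If two vertices [i], [j] dividing [m] were cut off from each other, each of
    the two arcs between them would contain such a [t], and the two distances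
    would not fit in one turn ([label_connected]).

    For the height, no variable divides all the generators, so a prime
    containing the ideal contains two distinct variables ['X_i], ['X_j], and
    [0], the ideal of ['X_i] and the prime itself form a strict chain
    ([height_ge2_monomials]). *)

Set Implicit Arguments.
Unset Strict Implicit.
Unset Printing Implicit Defensive.

Import GRing.Theory.
Local Open Scope ring_scope.

(** * Ideals as boolean predicates *)

Definition ideal_of_closed (A : nzRingType) (S : {pred A})
    (S_ideal : idealr_closed S) : idealr A :=
  HB.pack (S : A -> bool) (isIdealr.Build A S S_ideal).

Section KernelIdeal.
Variables (A : nzRingType) (B : idomainType) (f : {rmorphism A -> B}).

Let ker : {pred A} := fun x => f x == 0.

Lemma kernel_idealr_closed : idealr_closed ker.
Proof.
split; rewrite ?unfold_in /ker ?rmorph0 ?rmorph1 ?oner_eq0 //.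
move=> a u v; rewrite !unfold_in /ker => /eqP fu /eqP fv.
by rewrite rmorphD rmorphM fu fv mulr0 addr0.
Qed.

Lemma kernel_prime_closed : prime_idealr_closed ker.
Proof. by move=> u v; rewrite !unfold_in /ker rmorphM mulf_eq0. Qed.

Definition kernel_prime : prime_idealr A :=
  HB.pack (ker : A -> bool) (isIdealr.Build A ker kernel_idealr_closed)
    (isPrimeIdealrClosed.Build A ker kernel_prime_closed).

Lemma mem_kernel_prime x : (x \in kernel_prime) = (f x == 0).
Proof. by []. Qed.

End KernelIdeal.

(** * Heights of monomial ideals *)

Section VariableInPrime.
Variables (k : fieldType) (r : nat).
Local Notation R := {mpoly k[r]}.

(** Substituting 0 for one variable realizes the ideal of that variable as the
    kernel of a map into a domain, which makes its primality immediate. *)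
Definition kill_var (i : 'I_r) : R -> R :=
  mmap (@mpolyC r k) (fun j => if j == i then 0 else 'X_j).

HB.instance Definition _ i := GRing.RMorphism.on (kill_var i).

Lemma kill_varX (i j : 'I_r) :
  kill_var i 'X_j = if j == i then 0 else 'X_j.
Proof. by rewrite /kill_var mmapX mmap1U. Qed.

Lemma prime_mem_var (P : prime_idealr R) (m : 'X_{1..r}) :
  'X_[m] \in P -> exists2 i, 'X_i \in P & m i != 0%N.
Proof.
rewrite mpolyXE_id => mP; apply/exists_inP; move: mP; apply: contraLR.
rewrite negb_exists => /forallP noP.
elim/big_rec: _ => [|i x _ xP]; first by rewrite idealr1.
rewrite prime_idealrM negb_or xP andbT.
have := noP i; rewrite negb_and negbK.
case: (m i) => [|e]; first by rewrite idealr1.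
rewrite orbF => iP; elim: e => [|e IH]; first by rewrite expr1.
by rewrite exprS prime_idealrM negb_or iP.
Qed.

(** Modulo [P] the substitution fixes every variable, hence every polynomial; in
    particular the kernel of [kill_var i] lies in [P]. *)
Lemma sub_kill_var_mem (P : prime_idealr R) (i : 'I_r) (p : R) :
  'X_i \in P -> p - kill_var i p \in P.
Proof.
move=> iP; elim/mpolyind: p => [|c m p _ _ IH].
  by rewrite raddf0 subr0 rpred0.
rewrite rmorphD opprD addrACA rpredD // -mul_mpolyC rmorphM /=.
rewrite [kill_var i c%:MP]mmapC -mulrBr idealMr //.
rewrite mpolyXE_id rmorph_prod /=.
(* Congruence modulo P is multiplicative, so the variables suffice. *)
pose K (x y : R) := x - y \in P.
have K1 : K 1 1 by rewrite /K subrr rpred0.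
have KM x1 y1 x2 y2 : K x1 y1 -> K x2 y2 -> K (x1 * x2) (y1 * y2).
  rewrite /K => K1' K2'.
  have -> : x1 * x2 - y1 * y2 = x2 * (x1 - y1) + y1 * (x2 - y2) by ring.
  by rewrite rpredD // idealMr.
apply: (big_ind2 K) => // j _; rewrite rmorphXn /=.
have Kj : K 'X_j (kill_var i 'X_j).
  by rewrite /K kill_varX; case: eqP => [->|_]; rewrite ?subr0 // subrr rpred0.
by elim: (m j) => [|e IHe]; rewrite ?expr0 // !exprS KM.
Qed.

(** A prime containing [I] contains some variable ['X_i], and a monomial of [I]
    free of ['X_i] forces a second one into it, which separates it from the
    ideal of ['X_i]. *)
Lemma height_ge2_monomials (I : idealr R) :
  (0 < r)%N ->
  (forall i : 'I_r, exists2 m : 'X_{1..r}, 'X_[m] \in I & m i = 0%N) ->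
  height_ge 2 I.
Proof.
move=> r_gt0 avoid P IP.
have [m0 /IP/prime_mem_var[i iP _] _] := avoid (Ordinal r_gt0).
have [m /IP/prime_mem_var[j jP mj] mi] := avoid i.
have ji : j != i by apply: contraNneq mj => ->; rewrite mi.
exists (fun h => match h with
  | 0 => kernel_prime (idfun : {rmorphism R -> R})
  | 1 => kernel_prime (kill_var i)
  | _ => P end).
split=> // - [|[|//]] _; split.
- by move=> x /eqP /= ->; rewrite mem_kernel_prime rmorph0.
- exists 'X_i; first by rewrite mem_kernel_prime /= kill_varX eqxx.
  by rewrite mem_kernel_prime -msupp_eq0 msuppX.
- move=> x; rewrite mem_kernel_prime => /eqP x0.
  by rewrite -[x]subr0 -x0 sub_kill_var_mem.
exists 'X_j => //.
by rewrite mem_kernel_prime /= kill_varX (negbTE ji) -msupp_eq0 msuppX.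
Qed.

End VariableInPrime.

Section MonomialIdeal.
Variables (k : fieldType) (r : nat) (J : finType) (Y : J -> 'X_{1..r}).
Local Notation R := {mpoly k[r]}.

(** A monomial ideal is determined by its monomials; this gives the decidable
    membership that ideals, being boolean predicates, require. *)
Definition mem_monomials : {pred R} :=
  fun p => all (fun m => [exists j, (Y j <= m)%MM]) (msupp p).

Lemma mem_monomialsP (p : R) :
  reflect {in msupp p, forall m, exists j, (Y j <= m)%MM} (p \in mem_monomials).
Proof.
by apply: (iffP allP) => h m /h /existsP.
Qed.

Hypothesis Y_neq0 : forall j, Y j != 0%MM.

Lemma monomial_idealr_closed : idealr_closed mem_monomials.
Proof.
split.
- by apply/mem_monomialsP => m; rewrite mcoeff_msupp mcoeff0 eqxx.
- apply/mem_monomialsP => /(_ 0%MM).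
  rewrite msupp1 inE eqxx => /(_ isT) [j] /mnm_lepP Yj.
  have /negP[] := Y_neq0 j; apply/eqP/mnmP => i.
  by apply/eqP; have := Yj i; rewrite mnm0E leqn0.
move=> p u v /mem_monomialsP hu /mem_monomialsP hv; apply/mem_monomialsP => m.
move/msuppD_le; rewrite mem_cat => /orP[|/hv //].
move/msuppM_le => /allpairsP[[m1 m2] /= [_ /hu[j Yj] ->]].
by exists j; apply: lepm_trans Yj (lem_addl _ _).
Qed.

Definition monomial_ideal : idealr R := ideal_of_closed monomial_idealr_closed.

Lemma mem_monomial_ideal (p : R) :
  (p \in monomial_ideal) = (p \in mem_monomials).
Proof. by []. Qed.

Lemma monomial_ideal_homogeneous : homogeneous_ideal monomial_ideal.
Proof.
move=> p d; rewrite !mem_monomial_ideal => /mem_monomialsP hp.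
apply/mem_monomialsP => m; rewrite mcoeff_msupp => m_supp; apply: hp.
move: m_supp; rewrite mcoeff_msupp; apply: contra_neq => pm0.
rewrite pihomogE raddf_sum big1 //= => m' _.
by rewrite mcoeffZ mcoeffX; case: eqP => [->|_]; rewrite ?pm0 ?mul0r ?mulr0.
Qed.

Lemma monomial_ideal_gen j : 'X_[Y j] \in monomial_ideal.
Proof.
by rewrite mem_monomial_ideal; apply/mem_monomialsP => m;
  rewrite msuppX inE => /eqP ->; exists j; apply: lepm_refl.
Qed.

End MonomialIdeal.

(** * Division by monomials *)

Section MonomialDivision.
Variables (k : fieldType) (r : nat).
Local Notation R := {mpoly k[r]}.

Lemma mpolyX_neq0 (m : 'X_{1..r}) : 'X_[m] != 0 :> R.
Proof. by rewrite -msupp_eq0 msuppX. Qed.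

Lemma mulXB (m1 m2 : 'X_{1..r}) :
  (m1 <= m2)%MM -> 'X_[m2 - m1] * 'X_[m1] = 'X_[m2] :> R.
Proof. by move=> le12; rewrite -mpolyXD submK. Qed.

Lemma mdegBE (m1 m2 : 'X_{1..r}) :
  (m1 <= m2)%MM -> mdeg (m2 - m1)%MM = (mdeg m2 - mdeg m1)%N.
Proof. by move=> le12; rewrite -{2}(submK le12) mdegD addnK. Qed.

Lemma mpolyX_dvdP (F : 'X_{1..r}) (p : R) :
  {in msupp p, forall m, (F <= m)%MM} -> exists q, p = q * 'X_[F].
Proof.
move=> le_F; exists (\sum_(m <- msupp p) p@_m *: 'X_[m - F]).
rewrite mulr_suml [LHS]mpolyE; apply: eq_big_seq => m /le_F Fm.
by rewrite -scalerAl mulXB.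
Qed.

Lemma msuppMX_le (p : R) (F m : 'X_{1..r}) :
  m \in msupp (p * 'X_[F]) -> (F <= m)%MM.
Proof.
by rewrite (perm_mem (msuppMX _ _)) => /mapP[m' _ ->]; apply: lem_addr.
Qed.

End MonomialDivision.

(** * Monomial ideals resolved by a polygon *)

Section Polygon.
Variables (k : fieldType) (r n : nat) (Y : 'I_n -> 'X_{1..r}).
Local Notation R := {mpoly k[r]}.

Definition edge (j : 'I_n) : 'X_{1..r} := mlcm (Y (ord_pred j)) (Y j).

Definition vertex_map : 'M[R]_(n, 1) := \col_j 'X_[Y j].

(** The boundary of the edge [j] is its start minus its end.  Both coefficients
    are written with [edge j - Y i], so that the two cases read alike. *)
Definition edge_map : 'M[R]_n :=
  \matrix_(j, i) ((i == ord_pred j)%:R * 'X_[edge j - Y i]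
                  - (i == j)%:R * 'X_[edge j - Y i]).

Definition face_map (F : 'X_{1..r}) : 'M[R]_(1, n) := \row_j 'X_[F - edge j].

Lemma le_edge_pred j : (Y (ord_pred j) <= edge j)%MM.
Proof. exact: lem_mlcml. Qed.

Lemma le_edge j : (Y j <= edge j)%MM.
Proof. exact: lem_mlcmr. Qed.

Lemma le_edgeS j : (Y j <= edge (ordS j))%MM.
Proof. by rewrite -{1}[j]ordSK le_edge_pred. Qed.

Lemma mul_vertex_map (v : 'rV[R]_n) :
  v *m vertex_map = (\sum_j v 0 j * 'X_[Y j])%:M.
Proof.
apply/matrixP=> i j; rewrite !ord1 !mxE mulr1n.
by apply: eq_bigr => l _; rewrite !mxE.
Qed.

Lemma mul_edge_map (v : 'rV[R]_n) i :
  (v *m edge_map) 0 i =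
  v 0 (ordS i) * 'X_[edge (ordS i) - Y i] - v 0 i * 'X_[edge i - Y i].
Proof.
rewrite mxE; under eq_bigr do rewrite mxE mulrBr.
rewrite big_split /= sumrN; congr (_ - _).
  rewrite (bigD1 (ordS i)) //= ordSK eqxx mul1r big1 ?addr0 // => j ji.
  rewrite (_ : (i == _) = false) ?mul0r ?mulr0 //.
  by apply: contra_neqF ji => /eqP ->; rewrite ord_predK.
rewrite (bigD1 i) //= eqxx mul1r big1 ?addr0 // => j ji.
by rewrite eq_sym (negbTE ji) mul0r mulr0.
Qed.

Lemma row_edge_map j :
  row j edge_map =
  'X_[edge j - Y (ord_pred j)] *: delta_mx 0 (ord_pred j)
  - 'X_[edge j - Y j] *: delta_mx 0 j.
Proof. apply/rowP => i; rewrite !mxE !eqxx /=.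
by congr (_ - _); case: eqP => [->|_]; rewrite ?mul1r ?mulr1 ?mul0r ?mulr0.
Qed.

(** ** Exactness at the edges *)

(** If [v] is a cycle, consecutive products [v_j * 'X_[edge j]] agree, hence all
    of them do.  The monomials of their common value are divisible by every edge
    label, so by [F], and the quotient is the coefficient of the face. *)
Lemma exact_edges (F : 'X_{1..r}) : (0 < n)%N ->
  (forall j, (edge j <= F)%MM) ->
  (forall m, (forall j, (edge j <= m)%MM) -> (F <= m)%MM) ->
  exact_at (face_map F) edge_map.
Proof.
move=> n_gt0 le_F F_lub v; split=> [/rowP v0|[u ->]]; last first.
  apply/rowP => i; rewrite mul_edge_map !mxE !big_ord1 !mxE -!mulrA.
  apply/eqP; rewrite subr_eq0; apply/eqP; congr (_ * _).
  apply: (mulIf (mpolyX_neq0 _ (Y i))).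
  by rewrite -!mulrA !mulXB ?le_edge ?le_edgeS.
have step i : v 0 (ordS i) * 'X_[edge (ordS i)] = v 0 i * 'X_[edge i].
  have := v0 i; rewrite mul_edge_map mxE => /eqP; rewrite subr_eq0 => /eqP e.
  by rewrite -(mulXB _ (le_edge i)) mulrA -e -mulrA mulXB // le_edgeS.
pose p := v 0 (Ordinal n_gt0) * 'X_[edge (Ordinal n_gt0)].
have pE i : v 0 i * 'X_[edge i] = p.
  move: i => [l lt_ln]; elim: l lt_ln => [|l IH] lt_ln.
    by congr (v 0 _ * 'X_[edge _]); apply: val_inj.
  have -> : Ordinal lt_ln = ordS (Ordinal (ltnW lt_ln)).
    by apply: val_inj; rewrite /= modn_small.
  by rewrite step.
have [q pq] : exists q, p = q * 'X_[F].
  apply: mpolyX_dvdP => m m_p; apply: F_lub => j.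
  by apply: (@msuppMX_le _ _ (v 0 j)); rewrite pE.
exists q%:M; apply/rowP => j; rewrite !mxE big_ord1 !mxE mulr1n.
by apply: (mulIf (mpolyX_neq0 _ (edge j))); rewrite -mulrA mulXB // pE.
Qed.

Lemma face_map_inj (F : 'X_{1..r}) : (0 < n)%N ->
  injective (fun u : 'rV[R]_1 => u *m face_map F).
Proof.
move=> n_gt0 u v /rowP /(_ (Ordinal n_gt0)).
rewrite !mxE !big_ord1 !mxE => /(mulIf (mpolyX_neq0 _ _)) e.
by apply/rowP => j; rewrite ord1.
Qed.

(** ** Exactness at the vertices *)

Definition cycle_edge (S : pred 'I_n) : rel 'I_n :=
  [rel i j | [&& S i, S j & (i == ord_pred j) || (j == ord_pred i)]].

Definition vertices_below (m : 'X_{1..r}) : pred 'I_n := fun j => (Y j <= m)%MM.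

(** The condition for the polygon to resolve: in each multidegree the cycle
    restricted to the vertices present is connected, that is, has no reduced
    homology in degree 0. *)
Definition connected_below : Prop := forall m,
  {in vertices_below m &,
    forall i j, connect (cycle_edge (vertices_below m)) i j}.

Definition in_row_space (v : 'rV[R]_n) : Prop := exists u, v = u *m edge_map.

Lemma in_row_space0 : in_row_space 0.
Proof. by exists 0; rewrite mul0mx. Qed.

Lemma in_row_spaceD v w :
  in_row_space v -> in_row_space w -> in_row_space (v + w).
Proof. by move=> [u ->] [u' ->]; exists (u + u'); rewrite mulmxDl. Qed.

Lemma in_row_spaceZ p v : in_row_space v -> in_row_space (p *: v).
Proof. by move=> [u ->]; exists (p *: u); rewrite scalemxAl. Qed.

Lemma in_row_spaceB v w :
  in_row_space v -> in_row_space w -> in_row_space (v - w).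
Proof.
by move=> Iv Iw; rewrite -scaleN1r; apply/in_row_spaceD/in_row_spaceZ.
Qed.

(** The element of multidegree [m] supported at the vertex [j]. *)
Definition term (m : 'X_{1..r}) (j : 'I_n) : 'rV[R]_n :=
  'X_[m - Y j] *: delta_mx 0 j.

Lemma edge_term_in m j :
  vertices_below m (ord_pred j) -> vertices_below m j ->
  in_row_space (term m (ord_pred j) - term m j).
Proof.
move=> le_pred le_j.
have le_e : (edge j <= m)%MM by rewrite lem_mlcm; apply/andP.
exists ('X_[m - edge j] *: delta_mx 0 j).
rewrite -scalemxAl -rowE row_edge_map scalerBr !scalerA -!mpolyXD.
suff shift (y : 'X_{1..r}) :
    (y <= edge j)%MM -> (m - edge j + (edge j - y) = m - y)%MM.
  by rewrite !shift ?le_edge ?le_edge_pred.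
move=> le_y; apply: (@addIm _ y); rewrite submK ?(lepm_trans le_y) //.
by rewrite -addmA submK // submK.
Qed.

(** A path of vertices below [m] is a chain of edges of multidegree at most [m],
    and the boundaries of these edges telescope. *)
Lemma connect_term_in m i j :
  connect (cycle_edge (vertices_below m)) i j ->
  in_row_space (term m i - term m j).
Proof.
move=> /connectP[p]; elim: p i => [|l p IH] i /=.
  by move=> _ ->; rewrite subrr; apply: in_row_space0.
case/andP=> /and3P[Si Sl il] /IH{}IH /IH{}IH.
rewrite -(subrKA (term m l)); apply: in_row_spaceD IH.
case/orP: il => /eqP e; first by rewrite e; apply: edge_term_in; rewrite -?e.
by rewrite e -opprB -sub0r; apply: in_row_spaceB in_row_space0 _;
  apply: edge_term_in; rewrite -?e.
Qed.

(** A choice of one vertex in each multidegree.  Modulo boundaries it represents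
    all the terms of this multidegree, by connectedness. *)
Definition normal_term (m : 'X_{1..r}) : 'rV[R]_n :=
  if [pick j | vertices_below m j] is Some j then term m j else 0.

(** The linear extension of [normal_term].  The bound [N] on the degrees makes
    it a sum over a fixed finite type, so additivity in [p] is termwise. *)
Definition normal_form (N : nat) (p : R) : 'rV[R]_n :=
  \sum_(m : 'X_{1..r < N}) (p@_m)%:MP *: normal_term m.

Lemma normal_formD N p q :
  normal_form N (p + q) = normal_form N p + normal_form N q.
Proof.
by rewrite -big_split; apply: eq_bigr => m _; rewrite mcoeffD mpolyCD scalerDl.
Qed.

Lemma normal_form0 N : normal_form N 0 = 0.
Proof.
by rewrite /normal_form big1 // => m _; rewrite mcoeff0 mpolyC0 scale0r.
Qed.

Lemma normal_formX N c m : (mdeg m < N)%N ->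
  normal_form N (c *: 'X_[m]) = c%:MP *: normal_term m.
Proof.
move=> lt_mN; rewrite /normal_form (bigD1 (BMultinom lt_mN)) //= big1 ?addr0.
  by rewrite mcoeffZ mcoeffX eqxx mulr1.
move=> m' ne_m'; rewrite mcoeffZ mcoeffX.
rewrite (_ : (m == m') = false) ?mulr0 ?mpolyC0 ?scale0r //.
by apply: contra_neqF ne_m' => /eqP e; apply/val_inj.
Qed.

Hypothesis Y_connected : connected_below.

Lemma sub_normal_term_in m j : vertices_below m j ->
  in_row_space (term m j - normal_term m).
Proof.
move=> Sj; rewrite /normal_term.
case: pickP => [i Si|/(_ j)]; last by rewrite Sj.
by apply/connect_term_in/Y_connected.
Qed.

Lemma mul_normal_form_in N (p : R) j : (msize (p * 'X_[Y j]) <= N)%N ->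
  in_row_space (p *: delta_mx 0 j - normal_form N (p * 'X_[Y j])).
Proof.
move=> le_N; have pE : p * 'X_[Y j] = \sum_(m <- msupp p) p@_m *: 'X_[m + Y j].
  rewrite [p in LHS]mpolyE mulr_suml; apply: eq_bigr => m _.
  by rewrite -scalerAl mpolyXD.
have nfE (s : seq 'X_{1..r}) : {in s, forall m, mdeg (m + Y j)%MM < N}%N ->
    normal_form N (\sum_(m <- s) p@_m *: 'X_[m + Y j])
    = \sum_(m <- s) (p@_m)%:MP *: normal_term (m + Y j).
  elim: s => [|m s IH] lt_N; first by rewrite !big_nil normal_form0.
  rewrite !big_cons normal_formD normal_formX ?lt_N ?mem_head // IH // => l ls.
  by rewrite lt_N // inE ls orbT.
rewrite pE nfE => [|m m_p]; last first.
  apply: leq_trans le_N; apply: msize_mdeg_lt.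
  by rewrite (perm_mem (msuppMX _ _)) addmC; apply: map_f.
rewrite [p in p *: _]mpolyE scaler_suml -sumrB.
elim: (msupp p) => [|m s IH]; first by rewrite big_nil; apply: in_row_space0.
rewrite big_cons; apply: in_row_spaceD IH.
rewrite -mul_mpolyC -scalerA -scalerBr; apply: in_row_spaceZ.
have := @sub_normal_term_in (m + Y j)%MM j (lem_addl _ _).
by rewrite /term addmK.
Qed.

(** Modulo boundaries, [v] equals the sum over [j] of the normal forms of
    [v_j * 'X_[Y j]].  By linearity this is the normal form of their sum, which
    is 0 when [v] is a cycle. *)
Lemma exact_vertices : exact_at edge_map vertex_map.
Proof.
move=> v; split=> [|[u ->]]; last first.
  rewrite -mulmxA (_ : edge_map *m vertex_map = 0) ?mulmx0 //.
  apply/row_matrixP => j.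
  rewrite row_mul row_edge_map mulmxBl -!scalemxAl -!rowE.
  apply/rowP => i; rewrite !mxE !mulXB ?le_edge ?le_edge_pred //.
  by rewrite subrr.
rewrite mul_vertex_map => /matrixP /(_ 0 0); rewrite !mxE eqxx mulr1n => v0.
pose N := (\max_j msize (v 0%R j * 'X_[Y j]))%N.
have vE : v = \sum_j (v 0 j *: delta_mx 0 j - normal_form N (v 0 j * 'X_[Y j])).
  rewrite sumrB -row_sum_delta -(big_morph _ (normal_formD N) (normal_form0 N)).
  by rewrite v0 normal_form0 subr0.
rewrite vE; apply: (big_ind in_row_space) => [||j _].
- exact: in_row_space0.
- exact: in_row_spaceD.
by apply: mul_normal_form_in; apply: (leq_bigmax j).
Qed.

(** ** The resolution *)

Lemma monomial_ideal_exact (Y_neq0 : forall j, Y j != 0%MM) (f : R) :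
  f \in monomial_ideal k Y_neq0 <-> exists v : 'rV[R]_n, f%:M = v *m vertex_map.
Proof.
split=> [|[v]].
  rewrite mem_monomial_ideal => /mem_monomialsP f_in.
  have gen m : m \in msupp f ->
      exists v : 'rV[R]_n, 'X_[m]%:M = v *m vertex_map.
    move=> /f_in[j le_j]; exists (term m j).
    rewrite -scalemxAl -rowE; apply/rowP => i.
    by rewrite !mxE ord1 mulr1n mulXB.
  rewrite [f in f%:M]mpolyE; elim: (msupp f) gen => [|m s IH] gen.
    by exists 0; rewrite big_nil mul0mx; apply/rowP => i; rewrite !mxE mul0rn.
  have [|v ve] := IH; first by move=> l ls; apply: gen; rewrite inE ls orbT.
  have [v' ve'] := gen m (mem_head _ _).
  exists ((f@_m)%:MP *: v' + v).
  rewrite big_cons mulmxDl -ve -scalemxAl -ve' -mul_mpolyC raddfD /=.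
  by rewrite scale_scalar_mx.
rewrite mul_vertex_map => /matrixP /(_ 0 0); rewrite !mxE eqxx !mulr1n => ->.
by apply: rpred_sum => j _; apply/idealMr/monomial_ideal_gen.
Qed.

(** Strict growth of degrees from vertices to edges to the face is what makes
    the resolution minimal. *)
Lemma polygon_resolution (Y_neq0 : forall j, Y j != 0%MM) (F : 'X_{1..r})
    (a b : 'I_n -> nat) (s : nat) :
  (0 < n)%N ->
  (forall m, (F <= m)%MM = [forall j, (edge j <= m)%MM]) ->
  (forall j, mdeg (Y j) = a j) -> (forall j, mdeg (edge j) = b j) ->
  mdeg F = s ->
  (forall j, a j < b j)%N -> (forall j, a (ord_pred j) < b j)%N ->
  (forall j, b j < s)%N ->
  minimal_graded_resolution (monomial_ideal k Y_neq0) a b s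
    vertex_map edge_map (face_map F).
Proof.
move=> n_gt0 F_lub aE bE sE lt_ab lt_pab lt_bs.
have le_F j : (edge j <= F)%MM.
  by move: (F_lub F); rewrite lepm_refl => /esym/forallP.
have minX m : (0 < mdeg m)%N -> ('X_[m] : R)@_0%MM = 0.
  by rewrite lt0n mdeg_eq0 mcoeffX => /negbTE ->.
have edge_mapE j i : edge_map j i != 0 :> R ->
    (i == ord_pred j) || (i == j).
  apply: contraNT; rewrite negb_or => /andP[/negbTE ne1 /negbTE ne2].
  by rewrite mxE ne1 ne2 !mul0r subrr.
have edge_mapP j i : edge_map j i = 0 :> R \/
    [/\ (Y i <= edge j)%MM, (a i < b j)%N &
      edge_map j i \is (b j - a i)%N.-homog].
  have [->|/edge_mapE ij] := eqVneq (edge_map j i : R) 0; first by left.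
  right; have le_Y : (Y i <= edge j)%MM.
    by case/orP: ij => /eqP ->; rewrite ?le_edge ?le_edge_pred.
  split=> //; first by case/orP: ij => /eqP ->.
  have hom : ('X_[edge j - Y i] : R) \is (b j - a i)%N.-homog.
    by rewrite dhomogX /= mdegBE // aE bE.
  by rewrite mxE !mulr_natl rpredB // rpredMn.
split.
- move=> j i; split=> //; rewrite !mxE ?subn0 => _; by rewrite dhomogX /= aE.
- move=> j i; case: (edge_mapP j i) => [->|[_ lt h]]; split=> //.
    by rewrite rpred0.
  by move=> lt'; have := ltn_trans lt lt'; rewrite ltnn.
- move=> j i; split=> [_|lt].
    by rewrite mxE dhomogX /= mdegBE // bE sE.
  by have := ltn_trans lt (lt_bs i); rewrite ltnn.
- exact: monomial_ideal_exact.
- exact: exact_vertices.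
- by apply: exact_edges => // m le_m; rewrite F_lub; apply/forallP.
- exact: face_map_inj.
- move=> j i; rewrite mxE minX // lt0n mdeg_eq0; exact: Y_neq0.
- move=> j i; case: (edge_mapP j i) => [->|[le lt _]]; first by rewrite mcoeff0.
  rewrite mxE mcoeffB !mulr_natl !mcoeffMn minX ?mul0rn ?subrr //.
  by rewrite mdegBE // aE bE subn_gt0.
- by move=> j i; rewrite mxE minX // mdegBE // bE sE subn_gt0.
Qed.

End Polygon.

(** * Arcs in a cycle *)

Section Arcs.
Variable n : nat.

Lemma cycle_edge_sym (S : pred 'I_n) : ssrbool.symmetric (cycle_edge S).
Proof.
by move=> i j; rewrite /cycle_edge /= andbCA [X in _ && (_ && X)]orbC.
Qed.

Lemma val_ord_pred (j : 'I_n) :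
  ord_pred j = (if j == 0 :> nat then n.-1 else j.-1) :> nat.
Proof.
case: j => [[|j]] lt_jn /=.
  by rewrite add0n modn_small // ltn_predL.
by rewrite modnDr modn_small // ltnW.
Qed.

Lemma connect_up (S : pred 'I_n) (i j : 'I_n) : (i <= j)%N ->
  (forall l : 'I_n, (i <= l <= j)%N -> S l) -> connect (cycle_edge S) i j.
Proof.
move=> le_ij; have [N] := ubnP (j - i)%N.
elim: N j le_ij => // N IH j le_ij lt_N inS.
have [e|ne_ij] := eqVneq i j; first by rewrite e connect0.
have pE := val_ord_pred j.
have lt_ij : (i < j)%N by rewrite ltn_neqAle ne_ij.
have {}pE : ord_pred j = j.-1 :> nat by rewrite pE; case: eqP => //; lia.
apply: (connect_trans (IH (ord_pred j) _ _ _)); rewrite ?pE; try lia.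
  by move=> l il; apply: inS; lia.
by apply/connect1/and3P; split; rewrite ?eqxx //; apply: inS; lia.
Qed.

(** The other way round the cycle, through the edge joining 0 to [n-1]. *)
Lemma connect_down (S : pred 'I_n) (i j : 'I_n) : (i <= j)%N ->
  (forall l : 'I_n, (l <= i)%N || (j <= l)%N -> S l) ->
  connect (cycle_edge S) i j.
Proof.
move=> le_ij inS; have n_gt0 : (0 < n)%N by apply: leq_ltn_trans (ltn_ord i).
have [o oE] : exists o : 'I_n, o = 0 :> nat by exists (Ordinal n_gt0).
have pE : ord_pred o = n.-1 :> nat by rewrite val_ord_pred oE.
have lt_j := ltn_ord j; have conn_sym := sym_connect_sym (cycle_edge_sym S).
apply: (@connect_trans _ _ o).
  by rewrite conn_sym; apply: connect_up => [|l il]; [lia | apply: inS; lia].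
apply: (@connect_trans _ _ (ord_pred o)).
  by apply/connect1/and3P; split; rewrite ?eqxx ?orbT //; apply: inS; lia.
by rewrite conn_sym; apply: connect_up => [|l jl]; [lia | apply: inS; lia].
Qed.

Fact cyc_dist_subproof (j i : 'I_n) :
  ((if i <= j then j - i else j + n - i) < n)%N.
Proof. by case: j i => [j lt_j] [i lt_i] /=; case: ifP; lia. Qed.

(** [j - i] modulo [n]: the number of steps from [i] forward to [j]. *)
Definition cyc_dist (j i : 'I_n) : 'I_n := Ordinal (cyc_dist_subproof j i).

Lemma val_cyc_dist (j i : 'I_n) :
  cyc_dist j i = (if i <= j then j - i else j + n - i)%N :> nat.
Proof. by []. Qed.

(** [j - (j - i) = i]; hence summing over [i] amounts to summing over the
    distances. *)
Lemma cyc_distK j : involutive (cyc_dist j).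
Proof.
by case: j => [j lt_j] [i lt_i]; apply: val_inj => /=; do !case: ifP; lia.
Qed.

Lemma cyc_distxx (j : 'I_n) : cyc_dist j j = 0 :> nat.
Proof. by rewrite /= leqnn subnn. Qed.

Lemma cyc_dist_pred (j : 'I_n) : cyc_dist (ord_pred j) j = n.-1 :> nat.
Proof.
rewrite val_cyc_dist val_ord_pred.
by case: j => [[|j] lt_j] /=; do ?case: ifP; lia.
Qed.

Lemma cyc_distS (j i : 'I_n) : i != j ->
  cyc_dist j i = (cyc_dist (ord_pred j) i).+1 :> nat.
Proof.
rewrite -val_eqE !val_cyc_dist val_ord_pred.
case: j i => [[|j] lt_j] [i lt_i] /= ne_ij; do ?case: ifP; lia.
Qed.

End Arcs.

(** * The labels *)

Section Labels.
Variables (n a d : nat).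
Hypotheses (n_gt1 : (1 < n)%N) (d_gt0 : (0 < d)%N).
Hypotheses (nd_le_2a : (n * d <= 2 * a)%N) (a_lt : (a < n.-1 * d)%N).

(** The nonincreasing function with values in [0 .. d] that spends a total of
    [a] as early as possible: [d, ..., d, a mod d, 0, ..., 0]. *)
Definition exponent (t : nat) : nat := minn d (a - d * t).

Lemma exponent_le t : (exponent t <= d)%N.
Proof. exact: geq_minl. Qed.

Lemma exponent_anti t u : (t <= u)%N -> (exponent u <= exponent t)%N.
Proof. by move=> le_tu; rewrite /exponent; nia. Qed.

Lemma exponent0 : exponent 0 = d.
Proof. by rewrite /exponent; nia. Qed.

Lemma exponent_pred : exponent n.-1 = 0%N.
Proof. by rewrite /exponent; nia. Qed.

(** An exponent drops below [d] only after about [a / d >= n / 2] steps. *)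
Lemma exponent_lt t : (exponent t < d)%N -> (a < d * t.+1)%N.
Proof. by rewrite /exponent; nia. Qed.

Lemma sum_exponent : (\sum_(t < n) exponent t = a)%N.
Proof.
have partial m : (\sum_(t < m) exponent t = minn (d * m) a)%N.
  elim: m => [|m IH]; first by rewrite big_ord0 muln0 min0n.
  by rewrite big_ord_recr /= IH /exponent; nia.
by rewrite partial; nia.
Qed.

Definition label (j : 'I_n) : 'X_{1..n} :=
  [multinom exponent (cyc_dist j i) | i < n].

Definition face_label : 'X_{1..n} := [multinom d | i < n].

Lemma mdeg_label j : mdeg (label j) = a.
Proof.
rewrite mdegE -[RHS]sum_exponent [RHS](reindex_inj (inv_inj (cyc_distK j))).
by apply: eq_bigr => i _; rewrite mnmE.
Qed.

(** Moving from [j - 1] to [j] increases the distance from every [i <> j], so it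
    can only lower the exponents, except that of ['X_j], which jumps from
    [exponent n.-1 = 0] to [exponent 0 = d]. *)
Lemma edge_label j : edge label j = (label (ord_pred j) + U_(j) *+ d)%MM.
Proof.
apply/mnmP => i; rewrite !mnmE mulmnE mnm1E.
have [<-|ne_ji] := eqVneq j i.
  by rewrite mul1n cyc_distxx cyc_dist_pred exponent0 exponent_pred max0n.
rewrite mul0n addn0; apply/maxn_idPl/exponent_anti.
by rewrite (@cyc_distS _ j i) 1?eq_sym.
Qed.

Lemma mdeg_edge_label j : mdeg (edge label j) = (a + d)%N.
Proof. by rewrite edge_label mdegD mdeg_label mdegMn mdeg1 mul1n. Qed.

Lemma mdeg_face_label : mdeg face_label = (n * d)%N.
Proof.
rewrite mdegE (eq_bigr (fun=> d)) ?sum_nat_const ?card_ord // => i _.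
by rewrite mnmE.
Qed.

Lemma face_label_lub (m : 'X_{1..n}) :
  (face_label <= m)%MM = [forall j, (edge label j <= m)%MM].
Proof.
apply/mnm_lepP/forallP => [le_m j|le_m i].
  apply/mnm_lepP => i; apply: leq_trans (le_m i); rewrite !mnmE geq_max.
  by rewrite !exponent_le.
apply: leq_trans (mnm_lepP (le_m i) i).
by rewrite edge_label !mnmE mulmnE mnm1E eqxx mul1n leq_addl.
Qed.

(** Suppose that both arcs between [i] and [j] leave the set of vertices below
    [m], at [p] and at [q].  Some ['X_t] has a larger exponent at [p] than at
    [i] and [j]: going forward from [t] one meets [p] before [i] and [j], and
    these two are at distance more than [a / d - 1] from [t].  So [t] is on the
    arc of [p], and likewise there is some [u] on the arc of [q].  The way from
    [t] to [j] and that from [u] to [i] are disjoint, so their lengths add up to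
    at most [n - 2], against [n d <= 2 a]. *)
Lemma label_connected : connected_below label.
Proof.
move=> m; set S := vertices_below label m.
suff conn (i j : 'I_n) :
    (i <= j)%N -> i \in S -> j \in S -> connect (cycle_edge S) i j.
  move=> i j iS jS; case/orP: (leq_total i j) => ij; first exact: conn.
  by rewrite (sym_connect_sym (cycle_edge_sym S)); apply: conn.
move=> le_ij iS jS.
case: (boolP [forall l : 'I_n, (i <= l <= j)%N ==> S l]) => [/forallP up|].
  by apply: connect_up => // l; apply/implyP.
rewrite negb_forall => /existsP[p]; rewrite negb_imply => /andP[ipj pS].
case: (boolP [forall l : 'I_n, ((l <= i) || (j <= l))%N ==> S l])
  => [/forallP down|].
  by apply: connect_down => // l; apply/implyP.
rewrite negb_forall => /existsP[q]; rewrite negb_imply => /andP[qij qS].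
exfalso.
have cut (l : 'I_n) : ~~ S l -> exists t : 'I_n,
    [/\ (cyc_dist l t < cyc_dist i t)%N, (cyc_dist l t < cyc_dist j t)%N,
      (a < d * (cyc_dist i t).+1)%N & (a < d * (cyc_dist j t).+1)%N].
  rewrite /S /vertices_below /lem negb_forall => /existsP[t].
  rewrite -ltnNge mnmE => lt_t; exists t.
  have far (l' : 'I_n) : l' \in S ->
      (exponent (cyc_dist l' t) < exponent (cyc_dist l t))%N.
    by move=> /mnm_lepP /(_ t); rewrite mnmE => /leq_ltn_trans; apply.
  have closer (l' : 'I_n) : l' \in S -> (cyc_dist l t < cyc_dist l' t)%N.
    move=> /far; rewrite !ltnNge; apply: contra; exact: exponent_anti.
  have gap (l' : 'I_n) : l' \in S -> (a < d * (cyc_dist l' t).+1)%N.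
    by move=> /far lt; apply/exponent_lt/(leq_trans lt)/exponent_le.
  by split; rewrite ?closer ?gap.
have [t [pit pjt _ far_t]] := cut p pS.
have [u [qiu qju far_u _]] := cut q qS.
have : ((cyc_dist j t).+1 + (cyc_dist i u).+1 <= n)%N.
  move: pit pjt qiu qju; rewrite /=.
  have := (ltn_ord i, ltn_ord j, ltn_ord p, ltn_ord q, ltn_ord t, ltn_ord u).
  move=> [[[[[? ?] ?] ?] ?] ?] {far_t far_u}.
  by do !case: ifP; lia.
by nia.
Qed.

Lemma label_neq0 j : label j != 0%MM.
Proof. by rewrite -mdeg_eq0 mdeg_label; nia. Qed.

Lemma label_avoids i : label (ord_pred i) i = 0%N.
Proof. by rewrite mnmE cyc_dist_pred exponent_pred. Qed.

End Labels.

Theorem proposition4p15 (k : fieldType) (n : nat) (a_ b_ : 'I_n -> nat)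
    (a b s : nat)
    (hn : (3 <= n)%N) (n_even : ~~ odd n)
    (a_gt0 : forall i, (0 < a_ i)%N) (b_gt0 : forall j, (0 < b_ j)%N)
    (s_gt0 : (0 < s)%N)
    (a_const : forall i, a_ i = a) (b_const : forall j, b_ j = b)
    (s_eq : s = (n * (b - a))%N)
    (h_lt : (n * a < (n - 1) * b)%N)
    (h_le : ((n - 1) * b <= n * a + (n - 2) %/ 2 * (b - a))%N) :
  essential_betti_sequence k a_ b_ s.
Proof.
have lt_ab : (a < b)%N by nia.
pose d := (b - a)%N; have bE : b = (a + d)%N by rewrite subnKC // ltnW.
have d_gt0 : (0 < d)%N by rewrite subn_gt0.
have a_lt : (a < n.-1 * d)%N by nia.
have nd_le : (n * d <= 2 * a)%N.
  have half : (2 * ((n - 2) %/ 2) <= n - 2)%N by lia.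
  by nia.
have n_gt1 : (1 < n)%N by lia.
have Y_neq0 := label_neq0 n_gt1 d_gt0 nd_le a_lt.
exists n, (monomial_ideal k Y_neq0); split=> //.
- exact: monomial_ideal_homogeneous.
- apply: height_ge2_monomials => [|i]; first by lia.
  exists (label a d (ord_pred i)); first exact: monomial_ideal_gen.
  exact: label_avoids.
exists (vertex_map k (label a d)), (edge_map k (label a d)),
  (face_map k (label a d) (face_label n d)).
apply: polygon_resolution.
- exact: label_connected.
- by lia.
- exact: face_label_lub.
- by move=> j; rewrite a_const mdeg_label.
- by move=> j; rewrite b_const mdeg_edge_label.
- by rewrite mdeg_face_label s_eq.
- by move=> j; rewrite a_const b_const.
- by move=> j; rewrite a_const b_const.
by move=> j; rewrite b_const s_eq -/d bE; nia.
Qed.
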